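(* Let $1<p<\infty$, $\alpha\in\mathbb{R}$, $\beta>0$, and let $u\in C_c(\mathbb{N}_0)$ be a complex-valued finitely supported sequence with $u(0)=0$. Then $$\sum_{n=1}^{\infty}n^{\alpha}|u(n)-u(n-1)|^p=\sum_{n=1}^{\infty}w_{p,\alpha,\beta}(n)|u(n)|^p+\sum_{n=2}^{\infty}n^{\alpha}R_p\bigl(u(n),\varphi_\beta(n)\bigr),$$ where $$w_{p,\alpha,\beta}(n)=n^{\alpha}\left[\left(1-\left(1-\frac1n\right)^{\beta}\right)^{p-1}-\left(1+\frac1n\right)^{\alpha}\left(\left(1+\frac1n\right)^{\beta}-1\right)^{p-1}\right]\quad\text{for } n\ge2,$$ and $w_{p,\alpha,\beta}(1):=1-2^{\alpha}\left(2^{\beta}-1\right)^{p-1}$. Moreover, when $p=2$, this identity holds for every $\beta\in\mathbb{R}$.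
   Context: $\mathbb{N}_0=\{0,1,2,\dots\}$, and $C_c(\mathbb{N}_0)$ denotes the set of finitely supported sequences on $\mathbb{N}_0$. Set $\varphi_\beta(n):=n^{\beta}$ for $n\ge1$ (and $\varphi_\beta(0):=0$). For $1<p<\infty$ and $\xi,\eta\in\mathbb{C}$, $$C_p(\xi,\eta):=|\xi|^p-|\xi-\eta|^p-p|\xi-\eta|^{p-2}\operatorname{Re}\bigl((\xi-\eta)\overline{\eta}\bigr),$$ where the last term is understood to be $0$ when $\xi=\eta$. For sequences $u$ and $\varphi$ on $\mathbb{N}_0$ with $\varphi>0$ on $\{1,2,\dots\}$ and for $n\ge2$, $$R_p(u(n),\varphi(n)):=C_p\!\left(u(n)-u(n-1),\ \frac{\varphi(n-1)}{\varphi(n)}u(n)-u(n-1)\right)+\varphi(n-1)\bigl(\varphi(n)-\varphi(n-1)\bigr)^{p-1}C_p\!\left(\frac{u(n-1)}{\varphi(n-1)},\ \frac{u(n-1)}{\varphi(n-1)}-\frac{u(n)}{\varphi(n)}\right).$$ When $p=2$ the power $p-1$ equals $1$, so the expressions make sense also when $\varphi(n)-\varphi(n-1)$ is negative. *)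

(* Defs.v *)
From HB Require Import structures.
From mathcomp Require Import all_boot all_order all_algebra.
From mathcomp Require Import all_classical all_reals all_analysis.
From mathcomp Require Import complex.
Set Implicit Arguments.
Unset Strict Implicit.
Unset Printing Implicit Defensive.
Import Order.TTheory GRing.Theory Num.Theory.
Import numFieldNormedType.Exports.
Local Open Scope classical_set_scope.
Local Open Scope complex_scope.
Local Open Scope ring_scope.

(* The canonical norm of R[i] takes its values in R[i]; this is the modulus
   as an element of R. *)
Definition modulus (R : realType) (z : R[i]) : R := ComplexField.Normc.normc z.

Definition Cc (R : realType) : set (nat -> R[i]) :=
  [set u | finite_set [set n | u n != 0]].

Definition phi (R : realType) (beta : R) (n : nat) : R :=
  if n == 0%N then 0 else n%:R `^ beta.

(* [powR] agrees with x ^ q for x >= 0 but is 1 on every x < 0, whereas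
   x ^ 1 = x must hold for negative x too. *)
Definition rpow (R : realType) (x q : R) : R :=
  if q == 1 then x else x `^ q.

(* When xi = eta the last term vanishes whatever the value of
   [0 `^ (p - 2)], which is finite in Rocq. *)
Definition Cp (R : realType) (p : R) (xi eta : R[i]) : R :=
  modulus xi `^ p - modulus (xi - eta) `^ p
  - p * modulus (xi - eta) `^ (p - 2) * complex.Re ((xi - eta) * conjc eta).

Definition Rp (R : realType) (p : R) (u : nat -> R[i]) (f : nat -> R)
    (n : nat) : R :=
  Cp p (u n - u n.-1) ((f n.-1 / f n)%:C * u n - u n.-1)
  + f n.-1 * rpow (f n - f n.-1) (p - 1)
    * Cp p (u n.-1 / (f n.-1)%:C) (u n.-1 / (f n.-1)%:C - u n / (f n)%:C).

Definition w (R : realType) (p alpha beta : R) (n : nat) : R :=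
  if n == 1%N then 1 - 2 `^ alpha * rpow (2 `^ beta - 1) (p - 1)
  else n%:R `^ alpha *
    (rpow (1 - (1 - n%:R^-1) `^ beta) (p - 1)
     - (1 + n%:R^-1) `^ alpha * rpow ((1 + n%:R^-1) `^ beta - 1) (p - 1)).

(* For u in [Cc] only finitely many terms of each of the three series are
   nonzero, so the limits of partial sums below exist. *)
Definition weighted_hardy_identity (R : realType) (p alpha beta : R)
    (u : nat -> R[i]) : Prop :=
  \big[+%R/0]_(1 <= n <oo) (n%:R `^ alpha * modulus (u n - u n.-1) `^ p)
  = \big[+%R/0]_(1 <= n <oo) (w p alpha beta n * modulus (u n) `^ p)
    + \big[+%R/0]_(2 <= n <oo) (n%:R `^ alpha * Rp p u (phi beta) n).

(* Main.v *)
Require Import Defs.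
From mathcomp Require Import all_boot all_order all_algebra.
From mathcomp Require Import all_classical all_reals all_analysis.
From mathcomp Require Import complex.
From mathcomp Require Import ring lra zify.
Set Implicit Arguments.
Unset Strict Implicit.
Unset Printing Implicit Defensive.
Import Order.TTheory GRing.Theory Num.Theory.
Import numFieldNormedType.Exports.
Local Open Scope classical_set_scope.
Local Open Scope ring_scope.

(** Write a = u(n), b = u(n-1), s = phi(n), t = phi(n-1), d = s - t.  In both
    C_p-terms of R_p the difference xi - eta is a real multiple of a: it is
    (d/s) a in the first and a/s in the second.  Moreover the second eta is
    -1/t times the first, so after multiplication by t d^(p-1) the two real
    parts are opposite and cancel ([Rp_cancel]), leaving
    [[
      R_p = |a - b|^p - (d/s)^(p-1) |a|^p + (d/t)^(p-1) |b|^p.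
    ]]
    After multiplication by n^alpha this expresses n^alpha |u(n) - u(n-1)|^p
    through n^alpha R_p, a multiple of |u(n)|^p and a multiple of |u(n-1)|^p.
    Shifting the last one by an index makes the coefficient of |u(n)|^p equal
    to w(n), because ratios of consecutive values of phi are powers of
    1 - 1/n and 1 + 1/n ([w1], [wS]).  Hence the identity holds for partial
    sums up to one boundary term ([partial_sums]), and that term vanishes past
    the support of u.

    For p = 2 and decreasing phi the number d is negative.  The only facts
    about powers of d that enter are |d|^(p-2) d = d^(p-1), |d|^p = d d^(p-1)
    and (d c)^(p-1) = d^(p-1) c^(p-1) for c >= 0; they hold both for d >= 0
    and for p = 2, so that the two halves of the statement have one proof. *)

(** * Powers of possibly negative reals *)

Section RpowLemmas.
Variable R : realType.
Implicit Types x c p q : R.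

Lemma rpow_powR x q : 0 <= x -> rpow x q = x `^ q.
Proof. by rewrite /rpow; case: eqP => // -> ?; rewrite powRr1. Qed.

(** The condition under which [rpow x (p - 1)] is the genuine odd-type power
    sgn(x) |x|^(p-1): for p = 2 this is x itself, whatever its sign. *)
Definition admissible p x := (0 <= x) || (p == 2).

Lemma admissibleZ c p x : 0 <= c -> admissible p x -> admissible p (x * c).
Proof.
by move=> c0 /orP[x0|hp]; apply/orP; [left; rewrite mulr_ge0 | right].
Qed.

Lemma rpowM p x c : 0 <= c -> admissible p x ->
  rpow (x * c) (p - 1) = rpow x (p - 1) * c `^ (p - 1).
Proof.
move=> c0 /orP[x0|/eqP->].
  by rewrite !rpow_powR ?mulr_ge0 // powRM.
have -> : 2 - 1 = 1 :> R by lra.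
by rewrite /rpow eqxx powRr1.
Qed.

Lemma powR_normB2_mul p x : 1 < p -> admissible p x ->
  `|x| `^ (p - 2) * x = rpow x (p - 1).
Proof.
move=> p1 /orP[x0|/eqP->]; last first.
  have -> : 2 - 1 = 1 :> R by lra.
  by rewrite subrr powRr0 mul1r /rpow eqxx.
rewrite rpow_powR // ger0_norm //.
have [->|xn0] := eqVneq x 0; first by rewrite mulr0 powR0 //; lra.
by rewrite -{2}(powRr1 x0) -powRD ?xn0 ?implybT //; congr powR; lra.
Qed.

Lemma powR_norm_rpow p x : 1 < p -> admissible p x ->
  `|x| `^ p = x * rpow x (p - 1).
Proof.
move=> p1 hx; rewrite -powR_normB2_mul // mulrCA -expr2.
rewrite -(real_normK (num_real x)).
have [->|xn0] := eqVneq x 0.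
  by rewrite normr0 expr0n mulr0 powR0 //; lra.
rewrite -powR_mulrn // -powRD ?normr_eq0 ?xn0 ?implybT //.
by congr powR; lra.
Qed.

End RpowLemmas.

(** * Pointwise cancellation in the remainder *)

Section Identity.
Variable R : realType.
Implicit Types (p r s t : R) (a b z xi eta : R[i]).

Lemma modulus_ge0 z : 0 <= modulus z.
Proof. by case: z => x y; apply: sqrtr_ge0. Qed.

Lemma modulusZ r z : modulus (r%:C%C * z) = `|r| * modulus z.
Proof.
rewrite /modulus ComplexField.Normc.normcM; congr (_ * _).
by rewrite /= expr0n addr0 sqrtr_sqr.
Qed.

Lemma Re_mulrc r z : complex.Re (r%:C%C * z) = r * complex.Re z.
Proof. by case: z => x y /=; rewrite mul0r subr0. Qed.

Lemma conjcZ r z : conjc (r%:C%C * z) = r%:C%C * conjc z.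
Proof.
case: z => x y; apply/eqP; rewrite eq_complex /=.
by apply/andP; split; apply/eqP; ring.
Qed.

(** Merging the powers of |r| with the factor r coming out of the real part
    turns them into signed powers of r, which makes cross terms with
    different r comparable. *)
Lemma Cp_realmul p r xi eta z : 1 < p -> admissible p r ->
  xi - eta = r%:C%C * z ->
  Cp p xi eta = modulus xi `^ p - r * rpow r (p - 1) * modulus z `^ p
    - p * rpow r (p - 1) * modulus z `^ (p - 2)
      * complex.Re (z * conjc eta).
Proof.
move=> p1 hr e; rewrite /Cp e modulusZ -[_ * z * _]mulrA Re_mulrc.
rewrite !powRM ?normr_ge0 ?modulus_ge0 // powR_norm_rpow //.
by rewrite -powR_normB2_mul //; ring.
Qed.

(** The factor t d^(p-1) in front of the second C_p-term is the one for which
    its real part is opposite to that of the first: the powers of s agree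
    since (1/s)^(p-1) d^(p-1) = (d/s)^(p-1), and t absorbs the ratio -1/t of
    the two eta's.  The two contributions to |a|^p then add up to
    (d/s)^(p-1) (d/s + t/s) = (d/s)^(p-1). *)
Lemma Rp_cancel p s t a b (d := s - t) :
  1 < p -> 0 < s -> 0 < t -> admissible p d ->
  Cp p (a - b) ((t / s)%:C%C * a - b)
  + t * rpow d (p - 1) * Cp p (b / t%:C%C) (b / t%:C%C - a / s%:C%C)
  = modulus (a - b) `^ p - rpow (d / s) (p - 1) * modulus a `^ p
    + rpow (d / t) (p - 1) * modulus b `^ p.
Proof.
move=> p1 s0 t0 hd.
have sn0 : s != 0 by rewrite gt_eqF.
have tn0 : t != 0 by rewrite gt_eqF.
have si0 : 0 <= s^-1 by rewrite invr_ge0 ltW.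
have ti0 : 0 <= t^-1 by rewrite invr_ge0 ltW.
have adm c : 0 <= c -> admissible p c by move=> h; apply/orP; left.
have e1 : (a - b) - ((t / s)%:C%C * a - b) = (d / s)%:C%C * a.
  have -> : d / s = 1 - t / s by rewrite /d mulrBl divff.
  by rewrite rmorphB rmorph1; ring.
have e2 : b / t%:C%C - (b / t%:C%C - a / s%:C%C) = (s^-1)%:C%C * a.
  by rewrite fmorphV; ring.
have e3 : b / t%:C%C - a / s%:C%C = (- t^-1)%:C%C * ((t / s)%:C%C * a - b).
  rewrite mulrBr mulrA -rmorphM mulNr mulrA mulVf // mul1r.
  by rewrite !rmorphN !fmorphV; ring.
have hb : modulus (b / t%:C%C) = t^-1 * modulus b.
  by rewrite mulrC -fmorphV modulusZ ger0_norm.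
rewrite (Cp_realmul p1 (admissibleZ si0 hd) e1) (Cp_realmul p1 (adm _ si0) e2).
rewrite {}e3 conjcZ mulrCA Re_mulrc hb.
rewrite (powRM p ti0 (modulus_ge0 _)) -(ger0_norm ti0) powR_norm_rpow ?adm //.
rewrite (ger0_norm ti0) !rpowM // !(rpow_powR _ si0) !(rpow_powR _ ti0).
rewrite /d; set Z := complex.Re _; field.
by rewrite sn0 tn0.
Qed.
End Identity.

(** * Weights and partial sums *)

Section Weights.
Variable R : realType.
Implicit Types (p al be : R).

Lemma phi_gt0 be n : (0 < n)%N -> 0 < phi be n.
Proof. by move=> n0; rewrite /phi gtn_eqF // powR_gt0 // ltr0n. Qed.

Lemma phi_admissible p be n : (0 < be) || (p == 2) ->
  admissible p (phi be n.+1 - phi be n).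
Proof.
case/orP=> [be0|hp]; apply/orP; [left|by right].
rewrite subr_ge0 /phi /=; case: eqP => [_|_]; first exact: powR_ge0.
by apply: ge0_ler_powR; rewrite ?nnegrE ?ler_nat // ltW.
Qed.

Lemma phi_ratio be n : (0 < n)%N ->
  phi be n.+1 / phi be n = (1 + n%:R^-1) `^ be.
Proof.
move=> n0; have nR : n%:R != 0 :> R by rewrite pnatr_eq0 -lt0n.
rewrite /phi /= gtn_eqF //.
have -> : n.+1%:R = (1 + n%:R^-1) * n%:R :> R.
  by rewrite mulrDl mul1r mulVf // -natr1 addrC.
by rewrite powRM ?addr_ge0 ?invr_ge0 // mulfK // gt_eqF // powR_gt0 // ltr0n.
Qed.

Lemma phi_ratioV be n : (0 < n)%N ->
  phi be n / phi be n.+1 = (1 - n.+1%:R^-1) `^ be.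
Proof.
move=> n0; have nR : n.+1%:R != 0 :> R by rewrite pnatr_eq0.
rewrite /phi /= gtn_eqF //.
have -> : n%:R = (1 - n.+1%:R^-1) * n.+1%:R :> R.
  by rewrite mulrBl mul1r mulVf // -natr1 addrK.
rewrite powRM //; last by rewrite subr_ge0 invf_le1 ?ltr0n // ler1n.
by rewrite mulfK // gt_eqF // powR_gt0 // ltr0n.
Qed.

(** The coefficient of |u(n)|^p coming from the term of index n + 1, that is
    from the summand (d/t)^(p-1) |b|^p of the remainder; it is also the
    boundary term left over when the sums are cut after n. *)
Definition flux p al be n : R :=
  n.+1%:R `^ al * rpow ((phi be n.+1 - phi be n) / phi be n) (p - 1).

Lemma fluxE p al be n : (0 < n)%N ->
  flux p al be n
  = n%:R `^ al * ((1 + n%:R^-1) `^ al * rpow ((1 + n%:R^-1) `^ be - 1) (p - 1)).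
Proof.
move=> n0; have nR : n%:R != 0 :> R by rewrite pnatr_eq0 -lt0n.
rewrite /flux mulrBl divff ?gt_eqF ?phi_gt0 // phi_ratio // mulrA -powRM //.
by rewrite mulrDr mulr1 divff // natr1.
Qed.

(** Here the incoming coefficient is 1: as u(0) = 0, the term of index 1 is
    |u(1)|^p, and no remainder is attached to it. *)
Lemma w1 p al be : w p al be 1 = 1 - flux p al be 1.
Proof. by rewrite /w /= fluxE // invr1 powR1 mul1r -[1 + 1]/2%:R. Qed.

(** The weight is what |u(n+1)|^p receives from the term of index n + 1, minus
    what it passes on to the term of index n + 2. *)
Lemma wS p al be n : (0 < n)%N ->
  w p al be n.+1
  = n.+1%:R `^ al * rpow ((phi be n.+1 - phi be n) / phi be n.+1) (p - 1)
    - flux p al be n.+1.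
Proof.
move=> n0; rewrite /w eqSS gtn_eqF // (fluxE _ _ _ (ltn0Sn n)) mulrBr.
by rewrite [in RHS]mulrBl divff ?gt_eqF ?phi_gt0 // phi_ratioV.
Qed.

Lemma partial_sums p al be (u : nat -> R[i]) n :
  1 < p -> (0 < be) || (p == 2) -> u 0%N = 0 ->
  \sum_(1 <= k < n.+2) k%:R `^ al * modulus (u k - u k.-1) `^ p
  = \sum_(1 <= k < n.+2) w p al be k * modulus (u k) `^ p
    + \sum_(2 <= k < n.+2) k%:R `^ al * Rp p u (phi be) k
    + flux p al be n.+1 * modulus (u n.+1) `^ p.
Proof.
move=> p1 hbe u0; elim: n => [|n IH].
  rewrite !big_nat1 big_geq // w1 u0 subr0 powR1; ring.
rewrite big_nat_recr //= {}IH [in RHS]big_nat_recr //=.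
rewrite [X in _ = _ + X + _]big_nat_recr //=.
rewrite wS // {3}/Rp /= Rp_cancel ?phi_gt0 //; last exact: phi_admissible.
(* Only the flux into the last term is opened: it cancels against the summand
   of the remainder in |u(n+1)|^p, while the outgoing one is part of the
   weight. *)
rewrite {1}/flux.
move: (\sum_(1 <= _ < _) _) (\sum_(2 <= _ < _) _) (flux _ _ _ _) (n.+2%:R `^ al).
move: (rpow (_ / phi be n.+1) _) (rpow (_ / phi be n.+2) _).
by move: (_ `^ p) (_ `^ p) (_ `^ p) => *; ring.
Qed.

End Weights.

(** * Passage to the infinite sums *)

Lemma series_finite (R : realType) (m N : nat) (F : nat -> R) :
  (m <= N)%N -> (forall n, (N <= n)%N -> F n = 0) ->
  \big[+%R/0]_(m <= n <oo) F n = \sum_(m <= n < N) F n.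
Proof.
move=> mN F0; apply: lim_near_cst; first exact: norm_hausdorff.
exists N => // k /= Nk; rewrite (big_cat_nat mN Nk) /=.
by rewrite [X in _ + X]big_nat [X in _ + X]big1 ?addr0 //
  => i /andP[Ni _]; apply: F0.
Qed.

Lemma Cc_bounded (R : realType) (u : nat -> R[i]) : Cc u ->
  exists N, forall n, (N <= n)%N -> u n = 0.
Proof.
move=> hu.
exists (\max_(i <- finmap.enum_fset (fset_set [set n | u n != 0])) i).+1.
move=> n hn.
apply/eqP; apply: contraTT hn => un; rewrite -ltnNge ltnS.
apply: (leq_bigmax_seq (F := id)) => //.
by rewrite in_fset_set // inE.
Qed.

Lemma weighted_hardy (R : realType) (p alpha beta : R) (u : nat -> R[i]) :
  Cc u -> u 0%N = 0 -> 1 < p -> (0 < beta) || (p == 2) ->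
  weighted_hardy_identity p alpha beta u.
Proof.
move=> /Cc_bounded[N uN] u0 p1 hbe; rewrite /weighted_hardy_identity.
have pn0 : p != 0 by rewrite gt_eqF //; lra.
have mod0 : modulus (0 : R[i]) `^ p = 0.
  by rewrite /modulus ComplexField.Normc.normc0 powR0.
have uS n : (N.+2 <= n)%N -> u n = 0 /\ u n.-1 = 0.
  by case: n => // n hn; split; apply: uN => /=; lia.
(* The terms involve u(n-1), so they vanish from N + 1 on; N + 2 gives the
   upper bound the shape used for partial sums. *)
rewrite !(@series_finite _ _ N.+2) //.
- by rewrite (partial_sums _ _ p1 hbe u0) uN // mod0 mulr0 addr0.
- move=> n /uS[un um]; rewrite /Rp /Cp un um !(mulr0, mul0r, subrr, subr0).
  by rewrite addr0 mulr0.
- by move=> n /uS[-> _]; rewrite mod0 mulr0.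
- by move=> n /uS[-> ->]; rewrite subrr mod0 mulr0.
Qed.

Theorem corollary3p5 (R : realType) (alpha : R) (u : nat -> R[i])
    (hu : Cc u) (hu0 : u 0%N = 0) :
  (forall p beta : R, 1 < p -> 0 < beta ->
     weighted_hardy_identity p alpha beta u)
  /\ (forall beta : R, weighted_hardy_identity 2 alpha beta u).
Proof.
split=> [p beta p1 b0|beta]; apply: weighted_hardy => //.
- by rewrite b0.
- by rewrite ltr1n.
- by rewrite eqxx orbT.
Qed.
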